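(* For any $\gamma>0$, $\gamma\ne1$, and any integer $K\ge2$, we have the lower bound $$\inf_{Q,\hat F}\ \sup_{p\in\mathcal{P}_K}\mathbb{E}\left[(\hat F-F_\gamma)^2\right]\gtrsim_\gamma\frac{1}{\alpha^2n}+\frac{1}{(\alpha^2n)^\gamma},$$ where the infimum is taken over all estimators $\hat F$ and all $\alpha$-locally differentially private (LDP) sequentially interactive privacy mechanisms $Q$.
   Context: $n$ is a positive integer, $[K]=\{1,\dots,K\}$, and the privacy level $\alpha\in(0,1)$ satisfies $\alpha^2n\ge1$. $\mathcal{P}_K=\{p\in[0,1]^K:\sum_{k=1}^Kp_k=1\}$, and $F_\gamma=F_\gamma(p)=\sum_{k=1}^Kp_k^\gamma$. The sensitive data $x_1,\dots,x_n$ are i.i.d. with $\mathbb{P}(x_i=k)=p_k$, $k\in[K]$. A sequentially interactive privacy mechanism $Q=(Q_1,\dots,Q_n)$ generates private samples $z_1,\dots,z_n$ successively, $z_i$ being drawn from a conditional distribution $Q_i(\cdot\mid x_i,z_1,\dots,z_{i-1})$ (for $i=1$ there is no conditioning on previous $z$'s). It is $\alpha$-LDP if for all $i=1,\dots,n$, $$\sup_{z_1,\dots,z_{i-1},x_i,x_i'}\frac{Q_i(\cdot\mid x_i,z_1,\dots,z_{i-1})}{Q_i(\cdot\mid x_i',z_1,\dots,z_{i-1})}\le e^\alpha,$$ i.e. $Q_i(A\mid x_i,z_1,\dots,z_{i-1})\le e^\alpha Q_i(A\mid x_i',z_1,\dots,z_{i-1})$ for every measurable set $A$ and all values of the arguments.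 An estimator $\hat F$ is a measurable function of the private samples $z_1,\dots,z_n$. $x\gtrsim_\gamma y$ means $x\ge c_\gamma y$ for some constant $c_\gamma>0$ depending only on $\gamma$. *)

(* Defs.v *)
From HB Require Import structures.
From mathcomp Require Import all_boot all_order all_algebra.
From mathcomp Require Import all_classical all_reals all_analysis.

Set Implicit Arguments.
Unset Strict Implicit.
Unset Printing Implicit Defensive.

Import Order.TTheory GRing.Theory Num.Theory.
Import numFieldNormedType.Exports.

Local Open Scope classical_set_scope.
Local Open Scope ring_scope.

(* The probability simplex P_K. *)
Record simplex (R : realType) (K : nat) := Simplex {
  pmf :> 'I_K -> R ;
  pmf_itv : forall k, 0 <= pmf k <= 1 ;
  pmf_sum1 : \sum_(k < K) pmf k = 1 }.

Definition power_sum (R : realType) (K : nat) (gamma : R) (p : simplex R K) : R :=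
  \sum_(k < K) p k `^ gamma.

(* Law of (h, z) when h ~ P and then z ~ k(. | h). *)
Section extend_law.
Context d d' (H : measurableType d) (Z : measurableType d') (R : realType).
Variables (P : probability H R) (k : R.-pker H ~> Z).
Local Open Scope ereal_scope.

Definition extend_law (A : set (H * Z)) : \bar R :=
  \int[P]_h k h (xsection A h).

Let extend_law0 : extend_law set0 = 0.
Proof.
by rewrite /extend_law integral0_eq// => h _; rewrite xsection0 measure0.
Qed.

Let extend_law_ge0 A : 0 <= extend_law A.
Proof. by apply: integral_ge0 => h _; exact: measure_ge0. Qed.

Let extend_law_sigma_additive : semi_sigma_additive extend_law.
Proof.
move=> F mF tF mUF.
rewrite [X in _ --> X](_ : _ =
    \int[P]_h \sum_(0 <= i <oo) k h (xsection (F i) h)); last first.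
  apply: eq_integral => h _; rewrite xsection_bigcup.
  apply: measure_semi_bigcup => //.
  - by move=> i; exact: measurable_xsection.
  - exact: trivIset_xsection.
  - by apply: bigcup_measurable => i _; exact: measurable_xsection.
rewrite integral_nneseries//; last first.
  by move=> i; apply: measurable_fun_xsection_finite_kernel; rewrite inE.
by apply: is_cvg_nneseries => i _ _; exact: extend_law_ge0.
Qed.

HB.instance Definition _ := isMeasure.Build _ _ _ extend_law
  extend_law0 extend_law_ge0 extend_law_sigma_additive.

Let extend_law_setT : extend_law [set: H * Z] = 1.
Proof.
rewrite /extend_law; under eq_integral do rewrite xsectionE preimage_setT prob_kernel.
by rewrite integral_cst// mul1e; exact: probability_setT.
Qed.

HB.instance Definition _ :=
  Measure_isProbability.Build _ _ _ extend_law extend_law_setT.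

End extend_law.

(* Indices start at 0: [Z i] is the space of the (i+1)-st private sample, and
   [hist Z i] = Z_0 * ... * Z_{i-1} (left-nested, starting from [unit]) is the
   space of the first i private samples. *)
Fixpoint hist_display (d : nat -> measure_display) (i : nat) : measure_display :=
  if i is j.+1 then measure_prod_display (hist_display d j, d j)
  else default_measure_display.

Fixpoint hist (d : nat -> measure_display) (Z : forall i, measurableType (d i))
    (i : nat) : measurableType (hist_display d i) :=
  match i with
  | 0 => (unit : measurableType default_measure_display)
  | j.+1 => ((hist Z j * Z j)%type
               : measurableType (measure_prod_display (hist_display d j, d j)))
  end.

Section mechanisms.
Context (R : realType) (K : nat) (d : nat -> measure_display).
Variable Z : forall i, measurableType (d i).

(* [Q i k] is the conditional distribution of z_{i+1} given x_{i+1} = k and the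
   first i private samples. With n data only [Q i], i < n, is ever used; the
   others can be arbitrary, e.g. Dirac kernels. *)
Definition mechanism := forall i : nat, 'I_K -> R.-pker (hist Z i) ~> Z i.

Definition alpha_LDP (alpha : R) (n : nat) (Q : mechanism) : Prop :=
  forall i, (i < n)%N ->
  forall (h : hist Z i) (x x' : 'I_K) (A : set (Z i)), measurable A ->
    (Q i x h A <= (expR alpha)%:E * Q i x' h A)%E.

(* Conditional law of the private samples (z_1, ..., z_n) given the data. *)
Fixpoint cond_law (Q : mechanism) (n : nat) :
    ('I_n -> 'I_K) -> probability (hist Z n) R :=
  match n with
  | 0 => fun=> \d_(tt : hist Z 0)
  | m.+1 => fun x =>
      extend_law (cond_law Q (fun i : 'I_m => x (widen_ord (leqnSn m) i)))
                 (Q m (x ord_max))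
  end.

(* Unconditional law of the private samples when the data are i.i.d. from p. *)
Section private_law.
Variables (Q : mechanism) (n : nat) (p : simplex R K).
Local Open Scope ereal_scope.

Definition private_law (A : set (hist Z n)) : \bar R :=
  \sum_(x : {ffun 'I_n -> 'I_K}) (\prod_(i < n) p (x i))%:E * cond_law Q x A.

Let weight_ge0 (x : {ffun 'I_n -> 'I_K}) : (0 <= \prod_(i < n) p (x i))%R.
Proof. by apply: prodr_ge0 => i _; case/andP: (pmf_itv p (x i)). Qed.

Let private_law0 : private_law set0 = 0.
Proof. by apply: big1 => x _; rewrite measure0 mule0. Qed.

Let private_law_ge0 A : 0 <= private_law A.
Proof. by apply: sume_ge0 => x _; rewrite mule_ge0// lee_fin. Qed.

Let private_law_sigma_additive : semi_sigma_additive private_law.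
Proof.
move=> F mF tF mUF; rewrite /private_law.
under eq_fun do rewrite exchange_big/=.
apply: cvg_nnesum => x _.
  by apply: nearW => m; apply: sume_ge0 => i _; rewrite mule_ge0// lee_fin.
exact: (@measure_semi_sigma_additive _ _ _
  (mscale (NngNum (weight_ge0 x)) (cond_law Q x))).
Qed.

HB.instance Definition _ := isMeasure.Build _ _ _ private_law
  private_law0 private_law_ge0 private_law_sigma_additive.

Let private_law_setT : private_law [set: hist Z n] = 1.
Proof.
rewrite /private_law; under eq_bigr do rewrite probability_setT mule1.
rewrite sumEFin -(bigA_distr_bigA (fun _ => p : 'I_K -> R)) /=.
by rewrite big1// => i _; exact: pmf_sum1.
Qed.

HB.instance Definition _ :=
  Measure_isProbability.Build _ _ _ private_law private_law_setT.

End private_law.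

Definition risk (gamma : R) (n : nat) (Q : mechanism) (Fhat : hist Z n -> R)
    (p : simplex R K) : \bar R :=
  'E_(@private_law Q n p)[fun z => (Fhat z - power_sum gamma p) ^+ 2].

End mechanisms.

Arguments mechanism R K {d} Z.
Arguments private_law {R K d Z} Q n p A.

(* The infimum also ranges over the spaces in which the private samples live. *)
Definition minimax_risk (R : realType) (K n : nat) (alpha gamma : R) : \bar R :=
  ereal_inf [set r : \bar R |
    exists (d : nat -> measure_display) (Z : forall i, measurableType (d i))
           (Q : mechanism R K Z) (Fhat : hist Z n -> R),
      [/\ alpha_LDP alpha n Q,
          measurable_fun [set: hist Z n] Fhat &
          r = ereal_sup [set risk gamma Q Fhat p | p in [set: simplex R K]]] ].

(* Main.v *)
(* Write E_p, E_q for expectations under the laws of the private samples when the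
   data come from p = (1, 0, 0, ...) and q = (1 - e, e, 0, ...). Given the past,
   the next private sample has law Q_0 under p and (1 - e) Q_0 + e Q_1 under q,
   where Q_0 and Q_1 are within a factor exp(alpha) of each other; hence its
   chi-square divergence is O(e^2 alpha^2). Chi-square bounds, written without
   densities as (E_q f)^2 <= (1 + chi2) E_p(f^2), tensorize, so that
   (E_q f)^2 <= exp(O(n e^2 alpha^2)) E_p(f^2), with a bounded constant for
   e = 1 / (2 sqrt(alpha^2 n)). Le Cam's two-point method then bounds the risk
   from below by a multiple of (F(p) - F(q))^2 = (1 - (1 - e)^gamma - e^gamma)^2,
   which is at least of order e^2 + e^(2 gamma) since gamma <> 1. *)
Require Import Defs.
From mathcomp Require Import all_boot all_order all_algebra.
From mathcomp Require Import all_classical all_reals all_analysis.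
From mathcomp Require Import measurable_realfun ring lra.

Set Implicit Arguments.
Unset Strict Implicit.
Unset Printing Implicit Defensive.

Import Order.TTheory GRing.Theory Num.Theory.
Import numFieldNormedType.Exports.

Local Open Scope ring_scope.

(** * Integration against a law extended by one kernel step *)

Section integral_extend_law.
Context d d' (H : measurableType d) (Z : measurableType d') (R : realType).
Variables (P : probability H R) (k : R.-pker H ~> Z).
Local Open Scope ereal_scope.
Local Open Scope classical_set_scope.

Import HBNNSimple.

Let measurable_kernel_xsection (A : set (H * Z)) : measurable A ->
  measurable_fun [set: H] (fun h => k h (xsection A h)).
Proof.
by move=> mA; apply: measurable_fun_xsection_finite_kernel; rewrite inE.
Qed.

(** By linearity over the finite range of [f], this reduces to indicators, where it is the
    definition of [extend_law]. *)
Let integral_extend_law_nnsfun (f : {nnsfun (H * Z)%type >-> R}) :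
  \int[extend_law P k]_u (f u)%:E = \int[P]_h \int[k h]_z (f (h, z))%:E.
Proof.
pose A r := f @^-1` [set r].
have mA r : measurable (A r) by exact: measurable_sfunP.
have A0 r : (r < 0)%R -> A r = set0 by exact: preimage_nnfun0.
have mf r : measurable_fun [set: H * Z] (fun u => (r * \1_(A r) u)%:E).
  exact/measurable_EFinP/measurable_funM.
have slice r h : \int[k h]_z (r * \1_(A r) (h, z))%:E =
    r%:E * k h (xsection (A r) h).
  under eq_integral do rewrite indicE -mem_xsection -indicE.
  rewrite (integralZl_indic _ (fun r => xsection (A r) h))//.
  - by rewrite integral_indic ?setIT//; exact: measurable_xsection.
  - by move=> r0; rewrite A0// xsection0.
  - exact: measurable_xsection.
under [in LHS]eq_integral do rewrite fimfunE -fsumEFin//.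
rewrite ge0_integral_fsum//; last first.
  by move=> r u _; rewrite EFinM nnfun_muleindic_ge0.
under [in RHS]eq_integral.
  move=> h _.
  under eq_integral do rewrite fimfunE -fsumEFin//.
  rewrite ge0_integral_fsum//; last 2 first.
    - by move=> r; exact: measurableT_comp (mf r) (pair1_measurable h).
    - by move=> r z _; rewrite EFinM nnfun_muleindic_ge0.
  under eq_fsbigr do rewrite slice.
  over.
rewrite /= ge0_integral_fsum//; last 2 first.
  - by move=> r; exact/measurable_funeM/measurable_kernel_xsection.
  - move=> r h _; apply: (mulemu_ge0 (fun r => xsection (A r) h)) => r0.
    by rewrite A0// xsection0.
apply: eq_fsbigr => r _.
rewrite (integralZl_indic _ A)//; last exact: A0.
rewrite integral_indic// setIT /=.
(* A nonnegative level factors out of the integral; a negative one has an empty fibre, so both sides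
   vanish. *)
have [r0|r0] := leP 0%R r.
  by rewrite ge0_integralZl//; exact: measurable_kernel_xsection.
rewrite A0// measure0 mule0 integral0_eq// => h _.
by rewrite xsection0 measure0 mule0.
Qed.

(** Monotone convergence along simple approximations, applied once on the left and twice, inner then
    outer, on the right. *)
Lemma integral_extend_law (f : H * Z -> \bar R) :
  (forall u, 0 <= f u) -> measurable_fun [set: H * Z] f ->
  \int[extend_law P k]_u f u = \int[P]_h \int[k h]_z f (h, z).
Proof.
move=> f0 mf.
pose f_ := nnsfun_approx measurableT mf.
have mfn n : measurable_fun [set: H * Z] (EFin \o f_ n).
  exact/measurable_EFinP.
have mfn1 n h : measurable_fun [set: Z] (fun z => (f_ n (h, z))%:E).
  exact: measurableT_comp (mfn n) (pair1_measurable h).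
have ndf u : {homo (fun n => (f_ n u)%:E) : m n / (m <= n)%N >-> m <= n}.
  by move=> m n mn; rewrite lee_fin; exact/lefP/nd_nnsfun_approx.
have fE u : f u = limn (fun n => (f_ n u)%:E).
  by apply/esym/cvg_lim => //; exact: cvg_nnsfun_approx.
transitivity (limn (fun n => \int[extend_law P k]_u (f_ n u)%:E)).
  rewrite -monotone_convergence//; last 1 first.
    by move=> n u _; rewrite lee_fin.
  by apply: eq_integral => u _; exact: fE.
under eq_fun do rewrite integral_extend_law_nnsfun.
rewrite -monotone_convergence//; last 3 first.
- by move=> n; apply: (measurable_kfcomp k (mfn n)) => u; rewrite lee_fin.
- by move=> n h _; apply: integral_ge0 => // z _; rewrite lee_fin.
- by move=> h _ m n mn; apply: ge0_le_integral => //= *; rewrite ?lee_fin//;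
    exact: ndf.
apply: eq_integral => h _; rewrite -monotone_convergence//; last 1 first.
  by move=> n z _; rewrite lee_fin.
by apply: eq_integral => z _; rewrite fE.
Qed.

End integral_extend_law.

(** * Real integrals against measures of total mass one *)

Section unit_mass_measure.
Context d (T : measurableType d) (R : realType).
Implicit Types (m : {measure set T -> \bar R}) (f : T -> R).

Lemma integrable_bounded m f M : m setT = 1%E ->
  measurable_fun setT f -> (forall x, `|f x| <= M) ->
  m.-integrable setT (EFin \o f).
Proof.
move=> m1 mf fM; apply: measurable_bounded_integrable => //.
  by rewrite m1 ltry.
exists M; split; first exact: num_real.
by move=> y My x _; apply: le_trans (fM x) (ltW My).
Qed.

Lemma Rintegral_itv01 m f : m setT = 1%E -> measurable_fun setT f ->
  (forall x, 0 <= f x <= 1) -> 0 <= \int[m]_x f x <= 1.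
Proof.
move=> m1 mf f01; rewrite Rintegral_ge0/=; last by move=> x _; case/andP: (f01 x).
have -> : 1 = \int[m]_x (1 : R) :> R.
  by rewrite Rintegral_cst// m1 mulr1.
apply: le_Rintegral => //.
- by apply: (@integrable_bounded _ _ 1) => // x; rewrite ger0_norm; case/andP: (f01 x).
- by apply: (@integrable_bounded _ _ 1) => // x; rewrite normr1.
- by move=> x _; case/andP: (f01 x).
Qed.

(** Absorbing [a] into a scaled measure turns the setwise bound into monotonicity of the integral in
    the measure. The same inequality makes the [m1]-integral finite, as the passage to reals
    requires. *)
Lemma le_Rintegral_scale m0 m1 f (a : R) : 0 <= a ->
  (forall A, measurable A -> (m1 A <= a%:E * m0 A)%E) ->
  m0.-integrable setT (EFin \o f) -> (forall x, 0 <= f x) ->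
  \int[m1]_x f x <= a * \int[m0]_x f x.
Proof.
move=> a0 m10 if0 f0.
have mf : measurable_fun setT (EFin \o f) by case/integrableP: if0.
have le1 : (\int[m1]_x (f x)%:E <= a%:E * \int[m0]_x (f x)%:E)%E.
  have ->: (a%:E * \int[m0]_x (f x)%:E =
     \int[mscale (NngNum a0) m0]_x (f x)%:E)%E.
    by rewrite ge0_integral_mscale// => x _; rewrite lee_fin.
  exact: ge0_le_measure_integral.
have fin0 := integrable_fin_num measurableT if0.
rewrite /Rintegral -lee_fin EFinM (fineK fin0) fineK//.
rewrite ge0_fin_numE; last by apply: integral_ge0 => x _; rewrite lee_fin.
by apply: (le_lt_trans le1); rewrite -(fineK fin0) -EFinM ltry.
Qed.

(** The centre [c] stays free: the Cauchy-Schwarz argument for close measures comes from choosing it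
    well. *)
Lemma Rintegral_sqrB m f (c : R) : m setT = 1%E -> measurable_fun setT f ->
  (forall x, 0 <= f x <= 1) ->
  \int[m]_x (f x - c) ^+ 2 =
  \int[m]_x f x ^+ 2 - 2 * c * \int[m]_x f x + c ^+ 2.
Proof.
move=> m1 mf f01.
have f1 x : `|f x| <= 1 by rewrite ger0_norm; case/andP: (f01 x).
have if1 : m.-integrable setT (EFin \o f) by exact: integrable_bounded f1.
have if2 : m.-integrable setT (EFin \o (fun x => f x ^+ 2)).
  apply: (@integrable_bounded _ _ 1) => //.
    exact: measurable_funX.
  by move=> x; rewrite normrX expr_le1.
have ifc : m.-integrable setT (EFin \o (fun=> c ^+ 2)).
  by apply: (@integrable_bounded _ _ `|c ^+ 2|).
have ifZ : m.-integrable setT (EFin \o (fun x => 2 * c * f x)).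
  apply: (@integrable_bounded _ _ `|2 * c|) => //.
    exact: measurable_funM.
  by move=> x; rewrite normrM ler_piMr.
transitivity (\int[m]_x ((f x ^+ 2 - 2 * c * f x) + c ^+ 2)).
  by apply: eq_Rintegral => x _; ring.
rewrite RintegralD//; last first.
  exact: (integrableB measurableT if2 ifZ).
by rewrite RintegralB// RintegralZl// Rintegral_cst// m1 mulr1.
Qed.

End unit_mass_measure.

(** * Chi-square bound for a single private sample *)

(** Weighted arithmetic-geometric mean inequality, with no division by [e] in the statement; when
    [e] is zero the hypothesis forces [x] to vanish. *)
Lemma mulr2_le_addr (R : realFieldType) (e V x y : R) :
  0 <= e -> 0 <= V -> x ^+ 2 <= e * V -> 2 * y * x <= e * y ^+ 2 + V.
Proof.
move=> e0 V0 xeV; case: (eqVneq e 0) => [e_eq0|e_neq0].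
  have : x ^+ 2 <= 0 by rewrite (le_trans xeV)// e_eq0 mul0r.
  by rewrite real_exprn_even_le0 ?num_real//= => /eqP->; rewrite e_eq0; lra.
have e_gt0 : 0 < e by rewrite lt_neqAle eq_sym e_neq0.
rewrite -(ler_pM2l e_gt0); have := sqr_ge0 (e * y - x); nra.
Qed.

Section close_measures.
Context d (T : measurableType d) (R : realType).
Variables (m0 m1 : {measure set T -> \bar R}) (b : R).
Hypotheses (m0T : m0 setT = 1%E) (m1T : m1 setT = 1%E) (b1 : 1 < b).
Hypothesis m10 : forall A, measurable A -> (m1 A <= b%:E * m0 A)%E.
Hypothesis m01 : forall A, measurable A -> (m0 A <= b%:E * m1 A)%E.
Variable f : T -> R.
Hypotheses (mf : measurable_fun setT f) (f01 : forall x, 0 <= f x <= 1).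

Let E0 := \int[m0]_x f x.
Let S0 := \int[m0]_x f x ^+ 2.
Let E1 := \int[m1]_x f x.
Let S1 := \int[m1]_x f x ^+ 2.

Let le_sqrB (n0 n1 : {measure set T -> \bar R}) (c : R) :
  n0 setT = 1%E -> n1 setT = 1%E ->
  (forall A, measurable A -> (n1 A <= b%:E * n0 A)%E) ->
  \int[n1]_x f x ^+ 2 - 2 * c * \int[n1]_x f x + c ^+ 2 <=
  b * (\int[n0]_x f x ^+ 2 - 2 * c * \int[n0]_x f x + c ^+ 2).
Proof.
move=> n0T n1T n10; rewrite -!Rintegral_sqrB//; apply: le_Rintegral_scale => //.
- by rewrite ltW// (lt_trans ltr01).
- apply: (@integrable_bounded _ _ _ _ _ ((1 + `|c|) ^+ 2)) => //.
    exact/measurable_funX/measurable_funB.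
  move=> x; rewrite normrX lerXn2r// ?nnegrE ?addr_ge0//.
  rewrite (le_trans (ler_normB _ _))// lerD2r.
  by rewrite ger0_norm; case/andP: (f01 x).
- by move=> x; exact: sqr_ge0.
Qed.

Lemma sqr_Rintegral_le : E0 ^+ 2 <= S0.
Proof.
rewrite -subr_ge0.
have -> : S0 - E0 ^+ 2 = \int[m0]_x (f x - E0) ^+ 2.
  by rewrite Rintegral_sqrB// -/E0 -/S0; ring.
by apply: Rintegral_ge0 => x _; exact: sqr_ge0.
Qed.

(* Cauchy-Schwarz for the nonnegative measure [b m0 - m1], which integrates
   [f - E0] to [E0 - E1]. *)
Lemma sqr_RintegralB_le :
  (E1 - E0) ^+ 2 <= (b - 1) * (b - b^-1) * (S0 - E0 ^+ 2).
Proof.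
have a0 : 0 < b - 1 by rewrite subr_gt0.
have b0 : 0 < b by rewrite (lt_trans ltr01).
(* Minimizer in [t] of the integral of [(f - E0 + t) ^+ 2] against [b m0 - m1], a quadratic with
   leading coefficient [b - 1]. *)
pose t := (E1 - E0) / (b - 1).
have tE : E1 = E0 + t * (b - 1) by rewrite /t divfK ?gt_eqF//; ring.
have h1 := le_sqrB (E0 - t) m0T m1T m10.
have h0 := le_sqrB E0 m1T m0T m01.
rewrite -/E0 -/E1 -/S0 -/S1 in h0 h1.
(* The reverse domination keeps the [m1]-moment about [E0] above the variance divided by [b]. This
   yields [b - b^-1] in place of [b], so the final factor is quadratic in [b - 1], hence of order
   alpha squared. *)
have h0' : b^-1 * (S0 - E0 ^+ 2) <= S1 - 2 * E0 * E1 + E0 ^+ 2.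
  rewrite -(ler_pM2l b0) mulVKf ?gt_eqF//; apply: le_trans h0.
  by rewrite le_eqVlt; apply/orP; left; apply/eqP; ring.
have -> : E1 - E0 = t * (b - 1) by rewrite tE; ring.
have key : t ^+ 2 * (b - 1) <= (b - b^-1) * (S0 - E0 ^+ 2).
  by rewrite tE in h0' h1; lra.
have -> : (t * (b - 1)) ^+ 2 = (b - 1) * (t ^+ 2 * (b - 1)) by ring.
by rewrite -mulrA ler_pM2l.
Qed.

(** The mixture mean is [E0] plus [e * (E1 - E0)], whose square is at most [e ^+ 2 * B] times the
    variance. The cross term is split so that the squared mean and the variance both get the factor
    [1 + e ^+ 2 * B]; together they make [S0]. *)
Lemma sqr_Rintegral_mixture_le (e : R) :
  ((1 - e) * E0 + e * E1) ^+ 2 <= (1 + e ^+ 2 * ((b - 1) * (b - b^-1))) * S0.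
Proof.
have a0 : 0 <= b - 1 by rewrite subr_ge0 ltW.
have b0 : 0 < b by rewrite (lt_trans ltr01).
have c0 : 0 <= b - b^-1.
  by rewrite subr_ge0 (@le_trans _ _ 1) ?(ltW b1)// invf_le1// ltW.
have B0 := mulr_ge0 a0 c0.
have V0 := sqr_Rintegral_le; have tV := sqr_RintegralB_le.
set B := (b - 1) * (b - b^-1) in B0 tV *.
have e2 := sqr_ge0 e.
have xV : (e * (E1 - E0)) ^+ 2 <= (e ^+ 2 * B) * (S0 - E0 ^+ 2).
  by rewrite exprMn -mulrA ler_wpM2l.
have := @mulr2_le_addr _ _ (S0 - E0 ^+ 2) _ E0 (mulr_ge0 e2 B0) _ xV.
rewrite subr_ge0 => /(_ V0) h.
by nra.
Qed.

End close_measures.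

(** * Means of the private samples and their recursion *)

Lemma Rintegral_sum d (T : measurableType d) (R : realType)
    (m : {measure set T -> \bar R}) (I : finType) (f : I -> T -> R) :
  (forall i, m.-integrable setT (EFin \o f i)) ->
  \int[m]_x (\sum_i f i x) = \sum_i \int[m]_x f i x.
Proof.
move=> intf; rewrite /Rintegral.
under eq_integral do rewrite -sumEFin.
rewrite integral_sum// sum_fine// => i _.
exact: (integrable_fin_num measurableT (intf i)).
Qed.

Section kernel_integral.
Context d d' (H : measurableType d) (Z : measurableType d') (R : realType).
Variable (k : R.-pker H ~> Z).
Variable f : H * Z -> R.
Hypotheses (mf : measurable_fun setT f) (f01 : forall u, 0 <= f u <= 1).

Lemma measurable_fun_section h : measurable_fun setT (fun z => f (h, z)).
Proof. exact: measurableT_comp mf (pair1_measurable h). Qed.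

Lemma measurable_Rintegral_kernel :
  measurable_fun setT (fun h => \int[k h]_z f (h, z)).
Proof.
apply: measurableT_comp => //.
apply: (measurable_kfcomp k (f := EFin \o f)); first exact/measurable_EFinP.
by move=> u; rewrite lee_fin; case/andP: (f01 u).
Qed.

Lemma Rintegral_kernel_itv01 h : 0 <= \int[k h]_z f (h, z) <= 1.
Proof.
apply: Rintegral_itv01 => //; first exact: prob_kernel.
exact: measurable_fun_section.
Qed.

Lemma Rintegral_extend_law (P : probability H R) :
  \int[extend_law P k]_u f u = \int[P]_h \int[k h]_z f (h, z).
Proof.
congr fine; rewrite integral_extend_law.
- apply: eq_integral => h _; rewrite fineK//.
  apply: integrable_fin_num => //.
  apply: (@integrable_bounded _ _ _ _ _ 1); first exact: prob_kernel.
    exact: measurable_fun_section.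
  by move=> z; rewrite ger0_norm; case/andP: (f01 (h, z)).
- by move=> u; rewrite lee_fin; case/andP: (f01 u).
- exact/measurable_EFinP.
Qed.

End kernel_integral.

Section private_mean.
Context (R : realType) (K : nat) (d : nat -> measure_display).
Variables (Z : forall i, measurableType (d i)) (Q : mechanism R K Z).

(** Expectation under the law of the private samples, written in the reals as a finite mixture over
    data vectors so that it can be unrolled one sample at a time. It is matched with [private_law]
    on indicators. *)
Definition private_mean n (p : simplex R K) (f : hist Z n -> R) : R :=
  \sum_(x : {ffun 'I_n -> 'I_K}) (\prod_(i < n) p (x i)) * \int[cond_law Q x]_z f z.

Lemma private_mean_indic n p (A : set (hist Z n)) : measurable A ->
  private_law Q n p A = (private_mean p \1_A)%:E.
Proof.
move=> mA; rewrite /private_law /private_mean -sumEFin; apply: eq_bigr => x _.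
rewrite EFinM /Rintegral integral_indic// setIT fineK//.
exact: fin_num_measure.
Qed.

Lemma simplex_ge0 (p : simplex R K) k : 0 <= p k.
Proof. by case/andP: (pmf_itv p k). Qed.

(** The last datum is independent of the earlier ones, and the history depends only on those. So,
    given the history, the next sample follows the mixture of the kernels with weights [p]. *)
Lemma private_meanS n p (f : hist Z n.+1 -> R) :
  measurable_fun setT f -> (forall z, 0 <= f z <= 1) ->
  private_mean p f =
  private_mean p (fun h => \sum_k p k * \int[Q n k h]_z f (h, z)).
Proof.
move=> mf f01; rewrite /private_mean.
(* [F] appends a last datum and [G] splits it off; this bijection reindexes the sum over data
   vectors. *)
pose F (xk : {ffun 'I_n -> 'I_K} * 'I_K) : {ffun 'I_n.+1 -> 'I_K} := [ffun i : 'I_n.+1 =>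
  if unlift ord_max i is Some j then xk.1 j else xk.2].
pose G (x : {ffun 'I_n.+1 -> 'I_K}) : {ffun 'I_n -> 'I_K} * 'I_K :=
  ([ffun i : 'I_n => x (widen_ord (leqnSn n) i)], x ord_max).
(* [cond_law] reaches the first [n] indices by [widen_ord], while [unlift] speaks of
   [lift ord_max]. *)
have liftE (j : 'I_n) : widen_ord (leqnSn n) j = lift ord_max j.
  by apply: val_inj; rewrite /= /bump leqNgt ltn_ord.
have Fw xk j : F xk (widen_ord (leqnSn n) j) = xk.1 j.
  by rewrite ffunE liftE liftK.
have Fm xk : F xk ord_max = xk.2 by rewrite ffunE unlift_none.
rewrite (reindex F)/=; last first.
  exists G => [[x k]|x] _.
    rewrite /G Fm; congr pair; apply/ffunP => j.
    by rewrite ffunE Fw.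
  apply/ffunP => i; rewrite ffunE /=; case: unliftP => [j ->|->//].
  by rewrite ffunE liftE.
rewrite -(pair_bigA _ (fun x k => (\prod_(i < n.+1) p (F (x, k) i)) *
   \int[cond_law Q (F (x, k))]_z f z))/=.
apply: eq_bigr => x _; rewrite Rintegral_sum; last first.
  move=> k; apply: (@integrable_bounded _ _ _ _ _ 1).
  - exact: probability_setT.
  - apply: measurable_funM => //; exact: measurable_Rintegral_kernel.
  - move=> h; have /andP[I0 I1] := @Rintegral_kernel_itv01 _ _ _ _ _ (Q n k) _ mf f01 h.
    have /andP[p0 p1] := pmf_itv p k.
    by rewrite ger0_norm ?mulr_ge0// mulr_ile1.
rewrite big_distrr; apply: eq_bigr => k _ /=.
rewrite big_ord_recr Fm/= -mulrA; congr (_ * _).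
  by apply: eq_bigr => j _; rewrite Fw.
have -> : (fun i : 'I_n => F (x, k) (widen_ord (leqnSn n) i)) = x.
  by apply/funext => j; rewrite Fw.
rewrite RintegralZl//; last first.
  apply: (@integrable_bounded _ _ _ _ _ 1).
  - exact: probability_setT.
  - exact: measurable_Rintegral_kernel.
  - move=> h; have /andP[I0 I1] := @Rintegral_kernel_itv01 _ _ _ _ _ (Q n k) _ mf f01 h.
    by rewrite ger0_norm.
by rewrite Rintegral_extend_law.
Qed.

End private_mean.

(** * Tensorization of the chi-square bound and Le Cam's method *)

Section private_mean_theory.
Context (R : realType) (K : nat) (d : nat -> measure_display).
Variables (Z : forall i, measurableType (d i)) (Q : mechanism R K Z).

Lemma le_private_mean n p (f g : hist Z n -> R) (C : R) :
  measurable_fun setT f -> measurable_fun setT g ->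
  (forall z, 0 <= f z <= 1) -> (forall z, 0 <= g z <= 1) ->
  (forall z, f z <= C * g z) ->
  private_mean Q p f <= C * private_mean Q p g.
Proof.
move=> mf mg f01 g01 fg; rewrite /private_mean mulr_sumr.
apply: ler_sum => x _; rewrite mulrCA ler_wpM2l//.
  by apply: prodr_ge0 => i _; exact: simplex_ge0.
have bnd (u : hist Z n -> R) : measurable_fun setT u ->
    (forall z, 0 <= u z <= 1) ->
    (cond_law Q x).-integrable setT (EFin \o u).
  move=> mu u01; apply: (@integrable_bounded _ _ _ _ _ 1) => //.
    exact: probability_setT.
  by move=> z; rewrite ger0_norm; case/andP: (u01 z).
rewrite -RintegralZl//; last exact: bnd.
apply: le_Rintegral => //; first exact: bnd.
apply: (@integrable_bounded _ _ _ _ _ `|C|).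
- exact: probability_setT.
- exact: measurable_funM.
- move=> z; have /andP[g0 g1] := g01 z.
  by rewrite normrM ler_piMr// ger0_norm.
Qed.

Lemma private_mean0 p (f : hist Z 0 -> R) : private_mean Q p f = f tt.
Proof.
pose x0 : {ffun 'I_0 -> 'I_K} := ffun0 (card_ord 0).
rewrite /private_mean (big_pred1 x0); last first.
  by move=> x; apply/esym/eqP/ffunP => -[].
rewrite big_ord0 mul1r /Rintegral /= integral_dirac//.
by rewrite diracT mul1e.
Qed.

Section mixture.
Variables (n : nat) (p : simplex R K) (f : hist Z n.+1 -> R).
Hypotheses (mf : measurable_fun setT f) (f01 : forall z, 0 <= f z <= 1).

Lemma measurable_mixture :
  measurable_fun setT (fun h => \sum_k p k * \int[Q n k h]_z f (h, z)).
Proof.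
apply: measurable_sum => k; apply: measurable_funM => //.
exact: measurable_Rintegral_kernel.
Qed.

(** Integrating out the last sample stays within [[0, 1]]-valued test functions, the class on which
    the induction runs. *)
Lemma mixture_itv01 h : 0 <= \sum_k p k * \int[Q n k h]_z f (h, z) <= 1.
Proof.
have I01 k := @Rintegral_kernel_itv01 _ _ _ _ _ (Q n k) _ mf f01 h.
rewrite sumr_ge0/=; last first.
  by move=> k _; rewrite mulr_ge0 ?simplex_ge0//; case/andP: (I01 k).
rewrite -(pmf_sum1 p); apply: ler_sum => k _.
by rewrite ler_piMr ?simplex_ge0//; case/andP: (I01 k).
Qed.

End mixture.

(* The bound says that [1 + chi2(q || p) <= C ^+ n], the chi-square divergence being
   taken between the laws of the private samples; it tensorizes. *)
Lemma sqr_private_mean_le n (p q : simplex R K) (C : R) : 0 <= C ->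
  (forall i, (i < n)%N -> forall (h : hist Z i) (g : Z i -> R),
    measurable_fun setT g -> (forall z, 0 <= g z <= 1) ->
    (\sum_k q k * \int[Q i k h]_z g z) ^+ 2 <=
    C * \sum_k p k * \int[Q i k h]_z g z ^+ 2) ->
  forall f : hist Z n -> R,
  measurable_fun setT f -> (forall z, 0 <= f z <= 1) ->
  private_mean Q q f ^+ 2 <= C ^+ n * private_mean Q p (fun z => f z ^+ 2).
Proof.
move=> C0; elim: n => [|n IHn] step f mf f01.
  by rewrite !private_mean0 expr0 mul1r.
have mf2 : measurable_fun setT (fun z => f z ^+ 2) by exact: measurable_funX.
have f201 z : 0 <= f z ^+ 2 <= 1.
  by have /andP[f0 f1] := f01 z; rewrite sqr_ge0/= expr_le1.
rewrite !private_meanS//.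
have mq := measurable_mixture q mf f01.
have q01 := mixture_itv01 q mf f01.
(* The induction hypothesis is used for the conditional mean of [f] under [q]; the one-step bound
   then controls its square, history by history, by the conditional mean of [f ^+ 2] under [p]. *)
apply: le_trans (IHn _ _ mq q01) _.
  by move=> i lin; apply: step; rewrite ltnS ltnW.
rewrite exprSr -mulrA ler_wpM2l ?exprn_ge0//.
apply: le_private_mean.
- exact: measurable_funX.
- exact: (measurable_mixture p mf2 f201).
- by move=> h; have /andP[f0 f1] := q01 h; rewrite sqr_ge0/= expr_le1.
- exact: (mixture_itv01 p mf2 f201).
- move=> h; apply: (step n (ltnSn n) h (fun z => f (h, z))) => //.
  exact: measurable_fun_section.
Qed.

(** Markov's inequality for the squared loss. *)
Lemma mul_private_law_le_risk (gamma : R) n (Fhat : hist Z n -> R)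
    (p : simplex R K) (v : R) (A : set (hist Z n)) :
  measurable_fun setT Fhat -> measurable A -> 0 <= v ->
  (forall z, A z -> v <= (Fhat z - power_sum gamma p) ^+ 2) ->
  (v%:E * private_law Q n p A <= risk gamma Q Fhat p)%E.
Proof.
move=> mF mA v0 vA; rewrite /risk unlock.
have mloss : measurable_fun setT
    (fun z => ((Fhat z - power_sum gamma p) ^+ 2)%:E).
  exact/measurable_EFinP/measurable_funX/measurable_funB.
rewrite -integral_cst//.
apply: (@le_trans _ _ (\int[private_law Q n p]_(z in A)
    ((Fhat z - power_sum gamma p) ^+ 2)%:E)%E).
  by apply: ge0_le_integral => //; exact: measurable_funTS.
apply: ge0_subset_integral => //.
by move=> z _; rewrite lee_fin sqr_ge0.
Qed.

(* Le Cam's argument for the event [(Fhat - F p)^2 >= v / 4]: either it is likely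
   under [p], or the assumed bound makes it unlikely under [q] as well, and on its
   complement [Fhat] is far from [F q]. *)
Lemma two_point_risk (gamma : R) n (Fhat : hist Z n -> R)
    (p q : simplex R K) (C v : R) :
  measurable_fun setT Fhat -> 1 <= C -> 0 <= v ->
  (forall f : hist Z n -> R,
    measurable_fun setT f -> (forall z, 0 <= f z <= 1) ->
    private_mean Q q f ^+ 2 <= C * private_mean Q p (fun z => f z ^+ 2)) ->
  v <= (power_sum gamma p - power_sum gamma q) ^+ 2 ->
  ((v / (16 * C))%:E <= risk gamma Q Fhat p)%E \/
  ((v / (16 * C))%:E <= risk gamma Q Fhat q)%E.
Proof.
move=> mF C1 v0 CS sep.
have C0 : 0 < C by rewrite (lt_le_trans ltr01).
pose A : set (hist Z n) := [set z | v / 4 <= (Fhat z - power_sum gamma p) ^+ 2]%classic.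
have mA : measurable A.
  have mg : measurable_fun setT (fun z => (Fhat z - power_sum gamma p) ^+ 2).
    exact/measurable_funX/measurable_funB.
  have := mg measurableT _ (measurable_itv `[v / 4, +oo[).
  rewrite setTI; congr (measurable _); apply/seteqP; split => z;
    by rewrite /A/= in_itv/= andbT.
pose a := private_mean Q p \1_A; pose b := private_mean Q q \1_A.
have ab : b ^+ 2 <= C * a.
  (* An indicator equals its square, so the second moment in the bound is a probability. *)
  have -> : a = private_mean Q p (fun z => \1_A z ^+ 2).
    congr private_mean; apply/funext => z.
    by rewrite indicE; case: (z \in A); rewrite ?expr1n// expr0n.
  apply: CS => [|z]; first exact: measurable_indic.
  by rewrite indicE; case: (z \in A) => /=; rewrite lexx ler01.
have a0 : 0 <= a.
  by rewrite -lee_fin -private_mean_indic.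
have riskp : ((v / 4 * a)%:E <= risk gamma Q Fhat p)%E.
  rewrite EFinM -private_mean_indic//.
  by apply: mul_private_law_le_risk => //; rewrite divr_ge0.
have riskq : ((v / 4 * (1 - b))%:E <= risk gamma Q Fhat q)%E.
  have -> : ((v / 4 * (1 - b))%:E = (v / 4)%:E * private_law Q n q (~` A))%E.
    rewrite probability_setC// -[X in (_ * (1 - X))%E]/(private_law Q n q A).
    by rewrite private_mean_indic.
  apply: mul_private_law_le_risk => //.
  - exact: measurableC.
  - by rewrite divr_ge0.
  - move=> z /negP; rewrite -ltNge => small.
    rewrite leNgt; apply/negP => small'.
    (* Parallelogram identity: [(s - t) ^+ 2 + (2 * x - s - t) ^+ 2] is twice the sum of the two
       squared errors, hence below [v], contradicting the separation. *)
    move: sep small small' (sqr_ge0 (2 * Fhat z - power_sum gamma p - power_sum gamma q)).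
    move: (Fhat z) (power_sum gamma p) (power_sum gamma q) => x s t.
    by lra.
(* At this threshold the first case gives exactly [v / (16 * C)]; in the second, [b] is at most one
   half, leaving at least [v / 8]. *)
have [ale|alt] := leP (4 * C)^-1 a; [left|right].
  apply: le_trans riskp; rewrite lee_fin.
  have -> : v / (16 * C) = v / 4 * (4 * C)^-1.
    by field; rewrite gt_eqF.
  by rewrite ler_wpM2l// divr_ge0.
apply: le_trans riskq; rewrite lee_fin.
have b2 : b ^+ 2 < 4^-1.
  apply: le_lt_trans ab _; rewrite -ltr_pdivlMl//.
  by rewrite -invfM mulrC.
have b12 : b <= 2^-1 by nra.
have Cinv : C^-1 <= 1 by rewrite invf_le1.
rewrite invfM mulrA.
have : v / 16 * C^-1 <= v / 16 by rewrite ler_piMr// divr_ge0.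
by nra.
Qed.

End private_mean_theory.

(** * Two-point distributions and separation of their power sums *)

Section two_point.
Context (R : realType) (K : nat) (k0 k1 : 'I_K) (e : R).
Hypotheses (k01 : k1 != k0) (e01 : 0 <= e <= 1).

Let w (k : 'I_K) : R := if k == k0 then 1 - e else if k == k1 then e else 0.

(** Stated for any [F] vanishing at zero mass, to serve the total mass, means and power sums
    alike. *)
Let sum_w (F : 'I_K -> R -> R) : (forall k, F k 0 = 0) ->
  \sum_k F k (w k) = F k0 (1 - e) + F k1 e.
Proof.
move=> F0; rewrite (bigD1 k0)// (bigD1 k1)//= big1 => [|k /andP[kk0 kk1]].
  by rewrite addr0 /w eqxx (negbTE k01) eqxx.
by rewrite /w (negbTE kk0) (negbTE kk1).
Qed.

Let w_itv k : 0 <= w k <= 1.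
Proof.
have /andP[? ?] := e01; rewrite /w; case: ifP => _; [lra|].
by case: ifP => _; rewrite ?e01// lexx ler01.
Qed.

Let w_sum1 : \sum_k w k = 1.
Proof. by rewrite (@sum_w (fun=> id))// subrK. Qed.

Definition two_point : simplex R K := Simplex w_itv w_sum1.

Lemma two_point_sum (F : 'I_K -> R) :
  \sum_k two_point k * F k = (1 - e) * F k0 + e * F k1.
Proof. by rewrite (@sum_w (fun k x => x * F k))// => k; rewrite mul0r. Qed.

Lemma power_sum_two_point (gamma : R) : gamma != 0 ->
  power_sum gamma two_point = (1 - e) `^ gamma + e `^ gamma.
Proof.
move=> g0; rewrite /power_sum (@sum_w (fun _ x => x `^ gamma))// => _.
exact: powR0.
Qed.

End two_point.

(** Comparing [(1 - e)]^ gamma[with]1 - e[bounds the gap below by the distance between]e[and]e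
    [^ gamma]. The smaller of these is at most [h] times the larger, where [h] is the worst ratio,
    reached at one half. *)
Lemma power_sum_separation (R : realType) (gamma : R) :
  0 < gamma -> gamma != 1 -> exists2 c : R, 0 < c & forall e : R,
  0 < e <= 2^-1 -> c * (e ^+ 2 + (e `^ gamma) ^+ 2) <=
    (1 - ((1 - e) `^ gamma + e `^ gamma)) ^+ 2.
Proof.
move=> g0 g1; pose h : R := 2^-1 `^ `|gamma - 1|.
have h1 : h < 1.
  rewrite -(@powRr0 _ 2^-1) /h /powR; have -> : (2^-1 == 0 :> R) = false.
    by apply: negbTE; rewrite invr_eq0.
  rewrite ltr_expR mul0r pmulr_rlt0 ?normr_gt0 ?subr_eq0//.
  by rewrite ln_lt0// invr_gt0 ltr0n/= invf_lt1// ltr1n.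
exists ((1 - h) ^+ 2 / 2) => [|e /andP[e0 e2]].
  by rewrite divr_gt0// exprn_gt0// subr_gt0.
have eh : e `^ `|gamma - 1| <= h.
  by apply: ge0_ler_powR => //; rewrite nnegrE ?invr_ge0 ?ler0n ?(ltW e0).
have sq (x y u : R) : 0 <= x -> x <= y -> y * (1 - h) <= u ->
    (1 - h) ^+ 2 / 2 * (x ^+ 2 + y ^+ 2) <= u ^+ 2.
  move=> x0 xy yu.
  have y0 : 0 <= y := le_trans x0 xy.
  have yh : 0 <= y * (1 - h) by rewrite mulr_ge0// subr_ge0 ltW.
  have x2 : x ^+ 2 <= y ^+ 2 by rewrite lerXn2r.
  apply: (@le_trans _ _ ((y * (1 - h)) ^+ 2)).
    have := sqr_ge0 (1 - h); set q := (1 - h) ^+ 2; rewrite exprMn -/q => q0.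
    have := ler_wpM2l q0 x2; lra.
  by rewrite lerXn2r// nnegrE (le_trans yh).
have e1 : e <= 1 by rewrite (le_trans e2)// invf_le1// ler1n.
have e'01 : 0 < 1 - e <= 1 by lra.
have split_powR (r s : R) : e `^ (r + s) = e `^ r * e `^ s.
  by rewrite powRD//; apply/implyP => _; rewrite gt_eqF.
have [gl|gg|/eqP] := ltrgtP gamma 1; last by rewrite (negbTE g1).
- rewrite -[leRHS]sqrrN; apply: sq; first exact: ltW.
    by apply: ger1_powR; rewrite ?(ltW gl)// e0.
  have eE : e = e `^ gamma * e `^ `|gamma - 1|.
    rewrite ltr0_norm ?subr_lt0// -split_powR.
    by rewrite opprB addrC subrK powRr1// ltW.
  have := ger1_powR e'01 (ltW gl).
  have := ler_wpM2l (powR_ge0 e gamma) eh; rewrite -eE; lra.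
- rewrite (addrC (e ^+ 2)); apply: sq; first exact: powR_ge0.
    by apply: ge1r_powR; rewrite ?(ltW gg)// e0.
  have eE : e `^ gamma = e * e `^ `|gamma - 1|.
    by rewrite gtr0_norm ?subr_gt0// mulr_powRB1// ltW.
  have := ge1r_powR e'01 (ltW gg).
  have := ler_wpM2l (ltW e0) eh; rewrite -eE; lra.
Qed.

(** * Calibration to the privacy level and the final bound *)

Lemma expR_sub_le (R : realType) (a : R) : 0 < a -> a <= 1 ->
  (expR a - 1) * (expR a - (expR a)^-1) <= expR 1 * (expR 1 + 1) * a ^+ 2.
Proof.
move=> a0 a1; rewrite -expRN.
have N1 := expR_ge1Dx (- a).
have EN : expR a * expR (- a) = 1 by rewrite -expRD subrr expR0.
have E1 : expR a <= expR 1 by rewrite ler_expR.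
have Ea := expR_gt0 a.
have NE : expR (- a) <= 1 by rewrite -expR0 ler_expR oppr_le0 ltW.
have b1 : 1 <= expR a by rewrite -expR0 ler_expR ltW.
(* Multiply [1 - a <= expR (- a)] by [expR a]. *)
have u : expR a - 1 <= expR 1 * a by nra.
rewrite (_ : _ * a ^+ 2 = (expR 1 * a) * ((expR 1 + 1) * a)); last by ring.
apply: ler_pM => //; lra.
Qed.

Lemma sqr_two_point_mean_le (R : realType) (K : nat) (d : nat -> measure_display)
    (Z : forall i, measurableType (d i)) (Q : mechanism R K Z) (n : nat)
    (alpha : R) (k0 k1 : 'I_K) (k01 : k1 != k0) (e B : R)
    (e01 : 0 <= e <= 1) (z01 : 0 <= (0 : R) <= 1) (f : hist Z n -> R) :
  0 < alpha -> alpha <= 1 -> alpha_LDP alpha n Q ->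
  e ^+ 2 * (expR 1 * (expR 1 + 1) * alpha ^+ 2) * n%:R <= B ->
  measurable_fun setT f -> (forall z, 0 <= f z <= 1) ->
  private_mean Q (two_point k01 e01) f ^+ 2 <=
  expR B * private_mean Q (two_point k01 z01) (fun z => f z ^+ 2).
Proof.
move=> a0 a1 LDP eB mf f01.
have b1 : 1 < expR alpha by rewrite -expR0 ltr_expR.
have b0 := expR_gt0 alpha.
pose C := 1 + e ^+ 2 * ((expR alpha - 1) * (expR alpha - (expR alpha)^-1)).
have C0 : 0 <= C.
  apply: addr_ge0 => //; apply: mulr_ge0; first exact: sqr_ge0.
  apply: mulr_ge0; rewrite subr_ge0; first exact: ltW.
  by rewrite (le_trans _ (ltW b1))// invf_le1// ltW.
have mean2 : private_mean Q (two_point k01 e01) f ^+ 2 <=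
    C ^+ n * private_mean Q (two_point k01 z01) (fun z => f z ^+ 2).
  apply: sqr_private_mean_le => // i lin h g mg g01.
  (* With zero mass on [k1], the mixture under [p] is the single kernel at [k0]. *)
  rewrite !two_point_sum subr0 mul1r mul0r addr0.
  apply: sqr_Rintegral_mixture_le => //; try exact: prob_kernel.
  - by move=> A mA; exact: LDP.
  - by move=> A mA; exact: LDP.
apply: (le_trans mean2); apply: ler_wpM2r.
  apply: sumr_ge0 => x _; apply: mulr_ge0.
    by apply: prodr_ge0 => i _; exact: simplex_ge0.
  by apply: Rintegral_ge0 => z _; exact: sqr_ge0.
(* Bounding [1 + x] by [expR x] turns the [n]-th power into a factor [n] in the exponent. *)
have CE : C <= expR (e ^+ 2 * (expR 1 * (expR 1 + 1) * alpha ^+ 2)).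
  apply: le_trans (expR_ge1Dx _).
  by rewrite lerD2l ler_wpM2l ?sqr_ge0// expR_sub_le.
apply: (@le_trans _ _ (expR (e ^+ 2 * (expR 1 * (expR 1 + 1) * alpha ^+ 2)) ^+ n)).
  by rewrite lerXn2r// nnegrE expR_ge0.
by rewrite -expRM_natr ler_expR.
Qed.

Unset Implicit Arguments.

Theorem theorem2p6 (R : realType) (gamma : R)
    (gamma_gt0 : 0 < gamma) (gamma_neq1 : gamma != 1) :
  exists c : R, 0 < c /\
    forall (K n : nat) (alpha : R),
      (2 <= K)%N -> (0 < n)%N -> 0 < alpha -> alpha < 1 ->
      1 <= alpha ^+ 2 * n%:R ->
      ((c * (1 / (alpha ^+ 2 * n%:R)
             + 1 / ((alpha ^+ 2 * n%:R) `^ gamma)))%:E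
       <= minimax_risk K n alpha gamma)%E.
Proof.
have [c c0 sep] := power_sum_separation gamma_gt0 gamma_neq1.
(* Value of the chi-square exponent when [e ^+ 2] is [1 / (4 * alpha ^+ 2 * n)]. *)
pose B : R := expR 1 * (expR 1 + 1) / 4.
pose C := expR B.
have C0 : 0 < C := expR_gt0 B.
have C1 : 1 <= C.
  by rewrite /C -[leLHS]expR0 ler_expR divr_ge0// mulr_ge0 ?addr_ge0 ?expR_ge0.
(* The factors are the coefficients of [S^-1] in [e ^+ 2] and of the inverse of [S]^ gamma[in](e
   [^ gamma) ^+ 2]. Both are at most one, so their product is below each. *)
pose t : R := 4^-1 * 4^-1 `^ gamma.
have q0 : 0 < 4^-1 `^ gamma :> R by rewrite powR_gt0// invr_gt0.
have q1 : 4^-1 `^ gamma <= 1 :> R.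
  rewrite -[leRHS](@powRr0 _ 4^-1); apply: ger_powR; last exact: ltW.
  by rewrite invr_gt0 ltr0n/= invf_le1// ler1n.
have t0 : 0 < t by rewrite mulr_gt0// invr_gt0.
exists (c * t / (16 * C)); split; first by rewrite divr_gt0 ?mulr_gt0.
move=> K n alpha K2 n0 a0 a1 S1; set S := alpha ^+ 2 * n%:R in S1 *.
have S0 : 0 < S by rewrite (lt_le_trans ltr01).
(* This keeps [e ^+ 2 * S] constant, and [S >= 1] gives [e <= 2^-1] as the separation requires. *)
pose e := (2 * Num.sqrt S)^-1.
have sS1 : 1 <= Num.sqrt S by rewrite -[leLHS]sqrtr1 ler_wsqrtr.
have sS0 : 0 < Num.sqrt S by rewrite sqrtr_gt0.
have e0 : 0 < e by rewrite invr_gt0 mulr_gt0.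
have e2 : e <= 2^-1.
  by rewrite lef_pV2 ?posrE ?mulr_gt0// ler_peMr.
have eS : e ^+ 2 = 4^-1 * S^-1.
  by rewrite exprVn exprMn sqr_sqrtr ?ltW// invfM; congr (_^-1 * _); ring.
have egS : (e `^ gamma) ^+ 2 = 4^-1 `^ gamma * (S `^ gamma)^-1.
  rewrite expr2 -powRM ?ltW// -expr2 eS powRM ?invr_ge0 ?(ltW S0)//.
  by congr (_ * _); rewrite -powR_inv1 ?(ltW S0)// -powRrM mulN1r powRN.
have e01 : 0 <= e <= 1 by lra.
have z01 : 0 <= (0 : R) <= 1 by rewrite lexx ler01.
have K0 : (0 < K)%N by rewrite (leq_trans _ K2).
pose k0 := Ordinal K0; pose k1 := Ordinal K2.
have k01 : k1 != k0 by [].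
apply: le_ereal_inf_tmp => _ [d [Z [Q [Fhat [LDP mF ->]]]]].
pose p := two_point k01 z01; pose q := two_point k01 e01.
pose v := c * (e ^+ 2 + (e `^ gamma) ^+ 2).
have v0 : 0 <= v by rewrite mulr_ge0 ?addr_ge0 ?sqr_ge0// ltW.
have vpq : v <= (power_sum gamma p - power_sum gamma q) ^+ 2.
  rewrite !power_sum_two_point ?gt_eqF// subr0 powR1 powR0 ?gt_eqF// addr0.
  by apply: sep; rewrite e0.
have CS (f : hist Z n -> R) : measurable_fun setT f ->
    (forall z, 0 <= f z <= 1) ->
    private_mean Q q f ^+ 2 <= C * private_mean Q p (fun z => f z ^+ 2).
  apply: (sqr_two_point_mean_le k01 e01 z01 a0 (ltW a1) LDP).
  have -> : e ^+ 2 * (expR 1 * (expR 1 + 1) * alpha ^+ 2) * n%:R =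
      B * (S^-1 * (alpha ^+ 2 * n%:R)).
    by rewrite eS /B; ring.
  by rewrite -/S mulVf ?mulr1// gt_eqF.
have vle : (c * t / (16 * C)) * (1 / S + 1 / S `^ gamma) <= v / (16 * C).
  rewrite mulrAC ler_wpM2r ?invr_ge0 ?mulr_ge0 ?(ltW C0)//.
  rewrite -mulrA ler_wpM2l ?(ltW c0)// eS egS !div1r mulrDr.
  have Si : 0 <= S^-1 by rewrite invr_ge0 ltW.
  have Sgi : 0 <= (S `^ gamma)^-1 by rewrite invr_ge0 powR_ge0.
  by apply: lerD; rewrite ler_wpM2r// /t ?ler_piMr ?ler_piMl// ?invf_le1 ?ler1n// ltW.
have [rp|rq] := two_point_risk mF C1 v0 CS vpq.
- apply: le_ereal_sup_tmp; exists (risk gamma Q Fhat p); first by exists p.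
  by apply: le_trans rp; rewrite lee_fin.
- apply: le_ereal_sup_tmp; exists (risk gamma Q Fhat q); first by exists q.
  by apply: le_trans rq; rewrite lee_fin.
Qed.
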